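(* Let $\mathcal X,\mathcal Y,\mathcal Z,\widetilde{\mathcal Z},\mathfrak Z,A,f,\Psi,\mu,\mathfrak L,\Delta,\mathfrak C,B$ be as in the setting described in the context, let $J_{\Psi_B\circ\mathfrak L}=f\circ A+\mu\,\Psi_B\circ\mathfrak L$, and assume the overall convexity condition $$(C_1):\quad f\circ A-\tfrac{\mu}{2}\|B\mathfrak L\,\cdot\|_{\widetilde{\mathcal Z}}^2\in\Gamma_0(\mathcal X).$$ Then the problem $$\operatorname*{minimize}_{x\in\mathcal X,\ \mathfrak Cx\in\Delta}\ J_{\Psi_B\circ\mathfrak L}(x)$$ has a minimizer if one of the following holds: (i) $f$ is coercive and $\mathfrak C^{-1}(\Delta)=\{x\in\mathcal X\mid \mathfrak Cx\in\Delta\}$ is asymptotically multipolyhedral; (ii) $f$ is coercive and $\operatorname{null}A\cap\operatorname{null}\mathfrak L=\{0_{\mathcal X}\}$; (iii) $f$ is bounded below and $\operatorname{null}\mathfrak L=\{0_{\mathcal X}\}$; (iv) $\mathfrak C^{-1}(\Delta)$ is bounded.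
   Context: Notation. All Hilbert spaces are finite-dimensional and real. $\Gamma_0(\mathcal H)$ is the set of proper lower semicontinuous convex functions $\mathcal H\to(-\infty,\infty]$; $\mathcal B(\mathcal H,\mathcal K)$ is the set of linear operators $\mathcal H\to\mathcal K$; $\operatorname{dom}\varphi=\{x\mid\varphi(x)<\infty\}$; $\operatorname{null}L$ is the null space of $L$. A function $\varphi\in\Gamma_0(\mathcal H)$ is coercive if $\varphi(x)\to\infty$ as $\|x\|\to\infty$ (equivalently, its recession function $\operatorname{rec}(\varphi)(x)=\lim_{\alpha\to+\infty}\varphi(u+\alpha x)/\alpha$, $u\in\operatorname{dom}\varphi$, is $>0$ for every $x\neq0$). Asymptotically multipolyhedral: a closed convex set $C\subset\mathcal H$ is asymptotically multipolyhedral if $C=S+K$ for some compact set $S\subset\mathcal H$ and some polyhedral cone $K\subset\mathcal H$ (a cone, i.e. $\alpha x\in K$ for $x\in K$, $\alpha>0$, which is a finite intersection of closed half-spaces). Setting. $\mathcal X,\mathcal Y,\mathcal Z,\widetilde{\mathcal Z},\mathfrak Z$ are finite-dimensional real Hilbert spaces; $A\in\mathcal B(\mathcal X,\mathcal Y)$; $f\in\Gamma_0(\mathcal Y)$ is (real-valued and) differentiable over $\mathcal Y$ with $\beta_{\nabla f}$-Lipschitz continuous gradient; $\Psi\in\Gamma_0(\mathcal Z)$ is coercive (and prox-friendly, i.e. its proximity operators are computable, a purely computational requirement); $\mu>0$; $\mathfrak L\in\mathcal B(\mathcal X,\mathcal Z)$; $\Delta\subset\mathfrak Z$ is a closed convex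 set (simple, i.e. its metric projection is computable); $\mathfrak C\in\mathcal B(\mathcal X,\mathfrak Z)$; $B\in\mathcal B(\mathcal Z,\widetilde{\mathcal Z})$; and $\operatorname{dom}(\Psi\circ\mathfrak L)\cap\mathfrak C^{-1}(\Delta)\neq\emptyset$. The generalized Moreau enhanced (GME) function of $\Psi$ is $$\Psi_B(\cdot)=\Psi(\cdot)-\min_{v\in\mathcal Z}\Big[\Psi(v)+\tfrac12\|B(\cdot-v)\|_{\widetilde{\mathcal Z}}^2\Big].$$ *)

(* Defs.v *)
From HB Require Import structures.
From mathcomp Require Import all_boot all_order all_algebra.
From mathcomp Require Import all_classical all_reals all_analysis.

Set Implicit Arguments.
Unset Strict Implicit.
Unset Printing Implicit Defensive.

Import Order.TTheory GRing.Theory Num.Theory.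
Import numFieldNormedType.Exports.

Local Open Scope classical_set_scope.
Local Open Scope ring_scope.

(* A finite-dimensional real Hilbert space: a finite-dimensional vector space
   whose norm (hence topology) is induced by an inner product. Completeness is
   automatic in finite dimension. *)
HB.mixin Record isHilbert (R : realType) V
    & NormedModule R V & Vector R V := {
  inner : {dot V for idfun};
  sqr_normE : forall x : V, `|x| ^+ 2 = inner x x
}.

#[short(type="hilbertType")]
HB.structure Definition Hilbert (R : realType) :=
  {V of NormedModule R V & Vector R V & isHilbert R V}.

Section convex_analysis.
Context {R : realType} {H : hilbertType R}.
Implicit Types (phi : H -> \bar R) (f : H -> R) (K C : set H).

Definition dom phi : set H := [set x | (phi x < +oo)%E].

Definition proper_fun phi := (forall x, phi x != -oo%E) /\ dom phi !=set0.

(* [+oo - oo] never occurs on the right-hand side for proper functions. *)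
Definition convex_efun phi := forall (x y : H) (t : R), 0 < t < 1 ->
  (phi (t *: x + (1 - t) *: y)%R <= t%:E * phi x + (1 - t)%:E * phi y)%E.

Definition Gamma0 phi :=
  [/\ proper_fun phi, lower_semicontinuous phi & convex_efun phi].

Definition coercive phi := forall M : R, exists r : R,
  forall x : H, r <= `|x| -> (M%:E <= phi x)%E.

Definition is_gradient f (x g : H) :=
  differentiable f x /\ 'd f x = (inner g : H -> R) :> (H -> R).

Definition halfspace (u : H) (b : R) : set H := [set x | inner u x <= b].

(* For the empty list the intersection is the whole space. *)
Definition polyhedral K := exists s : seq (H * R),
  (forall p, p \in s -> p.1 != 0) /\
  K = \bigcap_(p in [set` s]) halfspace p.1 p.2.

Definition is_cone K := forall (a : R) (x : H), 0 < a -> K x -> K (a *: x).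

Definition asymptotically_multipolyhedral C :=
  [/\ closed C, convex_set C
    & exists S K : set H, [/\ compact S, is_cone K, polyhedral K
        & C = [set x + y | x in S & y in K]]].

End convex_analysis.

(* The generalized Moreau enhancement of [Psi]. The minimum over [v] is written
   as an infimum; it is attained as soon as [Psi] is in [Gamma0] and coercive. *)
Definition gme (R : realType) (Z Zt : hilbertType R) (Psi : Z -> \bar R)
    (B : 'Hom(Z, Zt)) (z : Z) : \bar R :=
  (Psi z - ereal_inf (range (fun v : Z =>
     Psi v + (2^-1 * `|B (z - v)| ^+ 2)%R%:E)))%E.

Definition gme_cost (R : realType) (X Y Z Zt : hilbertType R)
    (A : 'Hom(X, Y)) (f : Y -> R) (mu : R) (Psi : Z -> \bar R)
    (L : 'Hom(X, Z)) (B : 'Hom(Z, Zt)) (x : X) : \bar R :=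
  ((f (A x))%:E + mu%:E * gme Psi B (L x))%E.

(* Main.v *)
(* J = f o A + mu Psi_B o L is the supremum, over v in dom Psi, of convex lower
   semicontinuous functions (expand the squared norm in the Moreau term and use
   (C_1)), so its sublevel sets are closed and convex. If J stays bounded along
   a ray of direction d, then B L d = 0, for otherwise (C_1) forces f o A to
   grow quadratically along it; Psi_B o L is then Psi o L up to a constant, so
   L d = 0 because Psi is coercive and f bounded below, and A d = 0 when f is
   coercive. Hence J is coercive on any complement of N = null A /\ null L
   (on the whole space in case (iii)), and it is constant along N. In case (i)
   it remains to see that S + K + N is closed: by Fourier-Motzkin elimination
   K + N is again an intersection of finitely many half-spaces. *)
Require Import Defs.
From HB Require Import structures.
From mathcomp Require Import all_boot all_order all_algebra.
From mathcomp Require Import all_classical all_reals all_analysis.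
From mathcomp Require Import ring lra.

Set Implicit Arguments.
Unset Strict Implicit.
Unset Printing Implicit Defensive.

Import Order.TTheory GRing.Theory Num.Theory.
Import numFieldNormedType.Exports.

Local Open Scope classical_set_scope.
Local Open Scope ring_scope.

(** * Finite-dimensional topology *)

Lemma continuous_sumZ (R : realType) (T : topologicalType)
    (W : normedModType R) (I : Type) (r : seq I) (g : I -> T -> R) (w : I -> W) :
  (forall i, continuous (g i)) ->
  continuous (fun u => \sum_(i <- r) g i u *: w i).
Proof.
move=> gc; elim: r => [|i r IHr] u.
  by under eq_fun do rewrite big_nil; exact: cst_continuous.
under eq_fun do rewrite big_cons.
by apply: cvgD; [apply: cvgZr_tmp; exact: gc|exact: IHr].
Qed.

Section finite_dimension.
Context {R : realType} {H : hilbertType R}.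

Let n := \dim {:H}.
Let e := vbasis {:H}.
Let comb (u : 'rV[R]_n) : H := \sum_(i < n) u ord0 i *: e`_i.
Let coords (x : H) : 'rV[R]_n := \row_i coord e i x.

Let coordsK x : comb (coords x) = x.
Proof.
rewrite {2}(coord_vbasis (memvf x)).
by apply: eq_bigr => i _; rewrite mxE.
Qed.

Let comb_inj0 u : comb u = 0 -> u = 0.
Proof.
have e_free : free e := basis_free (vbasisP {:H}).
move=> u0; apply/rowP => i; rewrite mxE.
by have := coord_sum_free (fun i => u ord0 i) i e_free; rewrite -/(comb u) u0 linear0.
Qed.

Let combZ a u : comb (a *: u) = a *: comb u.
Proof. by rewrite scaler_sumr; apply: eq_bigr => i _; rewrite mxE scalerA. Qed.

Let comb_continuous : continuous comb.
Proof.
by apply: continuous_sumZ => i; exact: coord_continuous.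
Qed.
(** Norm equivalence: [m] is the minimum of [|comb u|] on the unit sphere of row vectors, positive
    because [comb] is injective; homogeneity extends the bound. *)
Let comb_bound : exists2 m, 0 < m & forall u, m * `|u| <= `|comb u|.
Proof.
pose S := [set u : 'rV[R]_n | `|u| = 1].
have clS : closed S.
  rewrite (_ : S = (fun u => `|u|) @^-1` [set 1]); last by [].
  by apply: preimage_closed => [u _|]; [exact: norm_continuous|exact: closed_eq].
have bS : bounded_set S.
  by exists 1; split => // M M1 u /= ->; exact: ltW.
have cS := bounded_closed_compact bS clS.
(* The sphere is empty only in dimension zero, where every [u] is [0]. *)
have [[v Sv]|S0] := pselect (S !=set0); last first.
  exists 1 => // u; rewrite mul1r; have [->|u0] := eqVneq u 0; first by rewrite normr0.
  exfalso; apply: S0; exists (`|u|^-1 *: u).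
  by rewrite /S /= normrZ normfV normr_id mulVf // normr_eq0.
have [] := @compact_EVT_min _ _ (fun u => `|comb u|) S _ cS.
- by exists v.
- apply: continuous_subspaceT => u.
  by apply: continuous_comp; [exact: comb_continuous|exact: norm_continuous].
move=> c /set_mem Sc cmin; exists `|comb c|.
  rewrite normr_gt0; apply/eqP => /comb_inj0 c0.
  by move: Sc; rewrite /S /= c0 normr0 => /esym/eqP; rewrite oner_eq0.
move=> u; have [->|u0] := eqVneq u 0; first by rewrite normr0 mulr0.
have u_gt0 : 0 < `|u| by rewrite normr_gt0.
rewrite -ler_pdivlMr //.
have -> : `|comb u| / `|u| = `|comb (`|u|^-1 *: u)|.
  by rewrite combZ normrZ normfV normr_id mulrC.
by apply: cmin; rewrite inE /S /= normrZ normfV normr_id mulVf // gt_eqF.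
Qed.

Let coords_continuous : continuous coords.
Proof.
have [m m0 mP] := comb_bound.
have coords_lin : linear coords.
  by move=> a x y; apply/rowP => i; rewrite !mxE linearP.
pose f : {linear H -> 'rV[R]_n} :=
  HB.pack coords (GRing.isLinear.Build R H 'rV[R]_n _ coords coords_lin).
apply: (@bounded_linear_continuous _ _ _ f).
apply/linear_boundedP; near=> r => x.
have -> : f x = coords x by [].
rewrite (@le_trans _ _ (m^-1 * `|x|)) //.
  by rewrite -[in leRHS](coordsK x) mulrC ler_pdivlMr // mulrC.
by apply: ler_wpM2r => //; near: r; apply: nbhs_pinfty_ge; rewrite num_real.
Unshelve. all: by end_near. Qed.

(** The map factors through the coordinates, which are continuous by [comb_bound]. *)
Lemma findim_linear_continuous (W : normedModType R) (f : {linear H -> W}) :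
  continuous f.
Proof.
have -> : (f : H -> W) = (fun u : 'rV[R]_n => \sum_(i < n) u ord0 i *: f e`_i) \o coords.
  apply/funext => x /=; rewrite -{1}(coordsK x) linear_sum.
  by apply: eq_bigr => i _; rewrite linearZ.
move=> x; apply: continuous_comp; first exact: coords_continuous.
by apply: continuous_sumZ => i; exact: coord_continuous.
Qed.

Lemma findim_bounded_closed_compact (D : set H) :
  bounded_set D -> closed D -> compact D.
Proof.
move=> bD cD; have [m m0 mP] := comb_bound.
have -> : D = comb @` (comb @^-1` D).
  apply/seteqP; split => [x Dx|_ [u Du <-]//].
  by exists (coords x); rewrite /= coordsK.
apply: continuous_compact; first exact: continuous_subspaceT.
apply: bounded_closed_compact; last first.
  by apply: preimage_closed => // u _; exact: comb_continuous.
have [M [_ MP]] := bD.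
exists (m^-1 * (`|M| + 1)); split; first exact: num_real.
move=> N MN u Du; apply: le_trans (ltW MN).
rewrite mulrC ler_pdivlMr // mulrC (le_trans (mP u)) //.
by apply: MP => //; rewrite (le_lt_trans (ler_norm M)) // ltrDl.
Qed.

End finite_dimension.

(** * Minimization *)

Lemma lty_ex_le_fin (R : realType) (x : \bar R) :
  (x < +oo -> exists a : R, x <= a%:E)%E.
Proof.
by case: x => [r _|//|_]; [exists r|exists 0; rewrite leNye].
Qed.

Section minimization.
Context {R : realType}.
Local Open Scope ereal_scope.

(** The nonempty sublevel sets within [K] form a filter base; being closed, they all contain its
    cluster points. This covers infinite values of [F]. *)
Lemma compact_attains_min (T : topologicalType) (K : set T) (F : T -> \bar R) :
  compact K -> (forall a : R, closed [set x | F x <= a%:E]) -> K !=set0 ->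
  exists2 p, K p & forall y, K y -> F p <= F y.
Proof.
move=> cK clF [z Kz].
pose I := [set a : R | exists2 y, K y & F y <= a%:E].
pose S a := K `&` [set x | F x <= a%:E].
(* If no real level is reached, [F] is [+oo] on all of [K] and every point is a minimizer. *)
have [[a0 [y0 Ky0 y0a0]]|I0] := pselect (I !=set0); last first.
  exists z => // y Ky; case Fy : (F y) => [r| |]; last 2 first.
  - exact: leey.
  - by exfalso; apply: I0; exists 0%R; exists y => //; rewrite Fy ?lexx ?leNye.
  - by exfalso; apply: I0; exists r; exists y => //; rewrite Fy ?lexx ?leNye.
have SF : ProperFilter (filter_from I S).
  apply: filter_from_proper; last by move=> a [y Ky Fya]; exists y.
  apply: filter_from_filter; first by exists a0; exists y0.
  move=> a b Ia Ib; exists (Num.min a b).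
    by case: leP.
  move=> x [Kx /=]; rewrite EFin_min le_min => /andP[xa xb].
  by split; split.
have [p [Kp clp]] := cK _ SF (ex_intro2 _ _ a0 (ex_intro2 _ _ y0 Ky0 y0a0) (@subIsetl _ _ _)).
have Fp a : I a -> F p <= a%:E.
  move=> Ia; apply: (clF a) => U Up.
  have [|x [[Kx Fx] Ux]] := clp (S a) U _ Up; first by exists a.
  by exists x.
exists p => // y Ky; case Fy : (F y) => [r| |].
- by apply: Fp; exists y => //; rewrite Fy ?lexx ?leNye.
- exact: leey.
(* If [F y] is [-oo], every real level is reached, so [F p] is [-oo] too. *)
- have FpN a : F p <= a%:E by apply: Fp; exists y => //; rewrite Fy ?lexx ?leNye.
  case Fpq : (F p) => [q| |] //.
  + by have := FpN (q - 1)%R; rewrite Fpq lee_fin lerDl oppr_ge0 leNgt ltr01.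
  + by have := FpN 0%R; rewrite Fpq.
Qed.

Context {H : hilbertType R}.
Implicit Types (F : H -> \bar R) (D : set H).

Lemma attains_min_on F D (a : R) :
  (forall a : R, closed [set x | F x <= a%:E]) -> closed D ->
  bounded_set (D `&` [set x | F x <= a%:E]) ->
  D `&` [set x | F x <= a%:E] !=set0 ->
  exists2 p, D p & forall y, D y -> F p <= F y.
Proof.
move=> clF clD bD ne.
have cK := findim_bounded_closed_compact bD (closedI clD (clF a)).
have [p [Dp Fp] pmin] := compact_attains_min cK clF ne.
exists p => // y Dy; have [ya|/ltW ya] := leP (F y) a%:E; first exact: pmin.
exact: le_trans ya.
Qed.

Lemma lsc_closed_sublevel F (a : R) :
  lower_semicontinuous F -> closed [set x | F x <= a%:E].
Proof.
move=> /lower_semicontinuousP/(_ a) oF.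
rewrite (_ : [set x | _] = ~` [set x | a%:E < F x]); first exact: open_closedC.
by apply/seteqP; split => x /=; rewrite leNgt => /negP.
Qed.

Lemma coercive_bounded_sublevel F (a : R) :
  coercive F -> bounded_set [set x | F x <= a%:E].
Proof.
move=> /(_ (a + 1)%R)[r rP]; exists r; split; first exact: num_real.
move=> M rM x /= Fxa; rewrite leNgt; apply/negP => Mx.
have := le_trans (rP _ (ltW (lt_trans rM Mx))) Fxa.
by rewrite lee_fin gerDl leNgt ltr01.
Qed.

(** Coercivity makes sublevel sets compact, so the minimum is attained; it is finite because [F] is
    proper. *)
Lemma coercive_Gamma0_has_lbound F :
  Gamma0 F -> coercive F -> exists m : R, forall x, m%:E <= F x.
Proof.
move=> [[Fny [x0 x0F]] lscF _] coF.
have clF a := @lsc_closed_sublevel F a lscF.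
have Fx0 : F x0 = (fine (F x0))%:E.
  by rewrite fineK // fin_numE Fny /=; apply/eqP => Fx0; move: x0F; rewrite /dom /= Fx0.
have [|||p _ pmin] := @attains_min_on F setT (fine (F x0)) clF.
- exact: closedT.
- by rewrite setTI; exact: coercive_bounded_sublevel.
- by exists x0; split => //=; rewrite -Fx0.
exists (fine (F p)) => x; rewrite fineK ?pmin // fin_numE Fny /=.
apply/eqP => Fpy; move: x0F; rewrite /dom /= ltNge => /negP; apply.
by rewrite -Fpy; exact: pmin.
Qed.

Lemma closed_vspace (W : {vspace H}) : closed [set x : H | x \in W].
Proof.
pose g : 'End(H) := (\1%VF - projv W)%R.
rewrite (_ : [set x | _] = (fun x => `|g x|%R) @^-1` [set 0%R]); last first.
  apply/seteqP; split => x /=; rewrite !lfunE /= !lfunE /=.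
    by move=> /projv_id ->; rewrite subrr normr0.
  by move=> /normr0_eq0/subr0_eq ->; exact: memv_proj.
apply: preimage_closed => [u _|]; last exact: closed_eq.
apply: continuous_comp; last exact: norm_continuous.
exact: findim_linear_continuous.
Qed.

(** An unbounded sublevel set yields unit directions from [x0] towards ever farther points; by
    compactness they cluster at a direction along which [F] stays bounded, against the hypothesis on
    rays. *)
Lemma bounded_sublevel_of_rays F (W : {vspace H}) (x0 : H) :
  (forall a : R, closed [set x | F x <= a%:E]) ->
  (forall (a t : R) x y, (0 <= t <= 1)%R -> F x <= a%:E -> F y <= a%:E ->
     F ((1 - t) *: x + t *: y)%R <= a%:E) ->
  x0 \in W -> F x0 < +oo ->
  (forall d, d \in W -> d != 0%R -> forall a : R,
     exists2 t : R, (0 <= t)%R & a%:E < F (x0 + t *: d)%R) ->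
  forall a : R, bounded_set ([set x | x \in W] `&` [set x | F x <= a%:E]).
Proof.
move=> clF cvF Wx0 Fx0 rays a; apply: contrapT => nb.
(* The level is raised so that [x0] lies below it and convexity applies to segments from [x0]. *)
have [b Fx0b ab] : exists2 b : R, F x0 <= b%:E & (a <= b)%R.
  have [c Fx0c] := lty_ex_le_fin Fx0; exists (Num.max c a).
    by rewrite (le_trans Fx0c) // lee_fin le_max lexx.
  by rewrite le_max lexx orbT.
pose K := [set d : H | d \in W] `&` [set d : H | `|d|%R = 1%R].
pose S (t : R) := K `&` [set d | F (x0 + t *: d)%R <= b%:E].
have cK : compact K.
  apply: findim_bounded_closed_compact.
    by exists 1%R; split => // M M1 u [_ /= ->]; exact: ltW.
  apply: closedI; first exact: closed_vspace.
  rewrite (_ : [set _ | _] = (fun u => `|u|%R) @^-1` [set 1%R]); last by [].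
  by apply: preimage_closed => [u _|]; [exact: norm_continuous|exact: closed_eq].
(* A point [x] of the sublevel set with [|x| > t + |x0|] is farther than [t] from [x0]; the segment
   towards it gives the direction. *)
have S_ne (t : R) : (0 <= t)%R -> S t !=set0.
  move=> t0; have [x [Wx Fx] tx] : exists2 x,
      ([set x | x \in W] `&` [set x | F x <= a%:E]) x & (t + `|x0| < `|x|)%R.
    apply: contrapT => nx; apply: nb; exists (t + `|x0|)%R; split.
      exact: num_real.
    move=> M tM x Dx /=; rewrite leNgt; apply/negP => Mx; apply: nx.
    by exists x => //; exact: lt_trans Mx.
  have tB : (t < `|x - x0|)%R.
    by rewrite (lt_le_trans _ (lerB_dist _ _)) // ltrBrDr.
  have B0 := le_lt_trans t0 tB.
  exists (`|x - x0|^-1 *: (x - x0))%R; split; first split => /=.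
  - by rewrite memvZ // memvB.
  - by rewrite normrZ normfV normr_id mulVf // gt_eqF.
  - rewrite /= (_ : _ + _ = (1 - t / `|x - x0|) *: x0 + (t / `|x - x0|) *: x)%R.
      apply: cvF; [|exact: Fx0b|by rewrite (le_trans Fx) ?lee_fin].
      by rewrite divr_ge0 ?(ltW B0) //= ler_pdivrMr // mul1r ltW.
    by rewrite scalerA scalerBr scalerBl scale1r addrA addrAC.
(* By convexity on the segment from [x0], the sets [S t] shrink as [t] grows, hence form a filter
   base. *)
have S_dec (s t : R) : (0 <= s <= t)%R -> S t `<=` S s.
  move=> /andP[s0 st] d [Kd Fd]; split => //=.
  have [t0|t0] := eqVneq t 0%R.
    by rewrite (_ : s = 0%R) ?scale0r ?addr0 //; apply/eqP; rewrite eq_le s0 -t0 st.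
  have tgt0 : (0 < t)%R by rewrite lt_neqAle eq_sym t0 (le_trans s0).
  rewrite (_ : _ + _ = (1 - s / t) *: x0 + (s / t) *: (x0 + t *: d))%R.
    by apply: cvF => //; rewrite divr_ge0 ?(ltW tgt0) //= ler_pdivrMr ?mul1r.
  by rewrite scalerDr scalerA divfK // addrA -scalerDl subrK scale1r.
have SF : ProperFilter (filter_from [set t : R | (0 <= t)%R] S).
  apply: filter_from_proper; last by move=> t /= t0; exact: S_ne.
  apply: filter_from_filter; first by exists 0%R => /=.
  move=> s t /= s0 t0; exists (Num.max s t) => /=; first by rewrite le_max s0.
  by rewrite subsetI; split; apply: S_dec; rewrite le_max lexx ?orbT ?s0 ?t0.
have [|d [[/= Wd d1] cld]] := cK _ SF.
  by exists 0%R => //=; exact: subIsetl.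
have d0 : d != 0%R by rewrite -normr_eq0 d1 oner_eq0.
have [t t0] := rays d Wd d0 b.
rewrite ltNge => /negP; apply.
(* The condition is closed in [d], so the cluster direction inherits it at the [t] supplied by
   [rays]. *)
have clS : closed [set d | F (x0 + t *: d)%R <= b%:E].
  apply: (@preimage_closed _ _ (fun d => x0 + t *: d)%R _ _ (clF b)) => u _.
  by apply: cvgD; [exact: cvg_cst|apply: cvgZl_tmp; exact: cvg_id].
apply: clS => U Ud; have [|x [[_ Sx] Ux]] := cld (S t) U _ Ud; last by exists x.
by exists t.
Qed.

End minimization.

(** * Polyhedral cones *)

(** Serves to choose the eliminated coordinate between its lower and upper bounds; either list may
    be empty. *)
Lemma seq_separation (R : realType) (ls us : seq R) :
  (forall l u, l \in ls -> u \in us -> l <= u) ->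
  exists t, (forall l, l \in ls -> l <= t) /\ (forall u, u \in us -> t <= u).
Proof.
elim: ls => [|l ls IH] lu.
  elim: us {lu} => [|u us [t [_ tus]]]; first by exists 0.
  exists (Num.min u t); split => // v.
  by rewrite inE ge_min => /predU1P[->|/tus ->]; rewrite ?lexx ?orbT.
have [|t [lst tus]] := IH.
  by move=> k u kls; apply: lu; rewrite inE kls orbT.
exists (Num.max l t); split => [k|u uus].
  by rewrite inE le_max => /predU1P[->|/lst ->]; rewrite ?lexx ?orbT.
by rewrite ge_max tus // lu // mem_head.
Qed.

Section polyhedral_cones.
Context {R : realType} {H : hilbertType R}.

(** The polar cone of finitely many vectors. Zero vectors are allowed, unlike in [polyhedral],
    because elimination can produce them. *)
Definition polar_seq (s : seq H) : set H :=
  [set x | forall p, p \in s -> inner p x <= 0].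

Lemma closed_polar_seq s : closed (polar_seq s).
Proof.
rewrite (_ : polar_seq s = \bigcap_(p in [set` s]) halfspace p 0); last by [].
apply: closed_bigI => p _.
apply: (@preimage_closed _ _ (fun x => inner p x) _ _ (@closed_le _ 0)) => u _.
exact: findim_linear_continuous.
Qed.

(* Fourier-Motzkin elimination of the coordinate along [e]. *)
Lemma polar_seq_add_line s (e : H) :
  exists s', forall x, polar_seq s' x <-> exists t, polar_seq s (x + t *: e).
Proof.
(* As constraints on [t], vectors of [sp] give upper bounds and those of [sn] lower bounds; each
   pair is combined with positive coefficients that cancel the component along [e]. *)
pose sp := [seq p <- s | 0 < inner p e].
pose sn := [seq p <- s | inner p e < 0].
exists ([seq p <- s | inner p e == 0] ++
        [seq inner p e *: q - inner q e *: p | p <- sp, q <- sn]) => x.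
split=> [xP|[t xt] p]; last first.
  have xtE q : q \in s -> inner q x <= - (t * inner q e).
    by move=> /xt; rewrite linearD linearZ /= -lerBrDr sub0r.
  rewrite mem_cat mem_filter => /orP[/andP[/eqP pe /xtE]|].
    by rewrite pe mulr0 oppr0.
  case/allpairsP => -[q r] /= []; rewrite !mem_filter.
  move=> /andP[qe /xtE qs] /andP[re /xtE rs] ->.
  rewrite linearBl !linearZl_LR /= subr_le0.
  rewrite (le_trans (ler_wpM2l (ltW qe) rs)) //.
  rewrite (le_trans _ (ler_wnM2l (ltW re) qs)) //.
  by rewrite !mulrN mulrCA [in leRHS]mulrCA [inner q e * _]mulrC.
(* The combined constraint of a pair says that its lower bound is at most its upper bound. *)
have [|t [lt ut]] := @seq_separation R
    [seq - inner q x / inner q e | q <- sn] [seq - inner p x / inner p e | p <- sp].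
  move=> _ _ /mapP[q qn ->] /mapP[p pp ->].
  have := xP (inner p e *: q - inner q e *: p).
  have pq_in : inner p e *: q - inner q e *: p
      \in [seq inner p e *: q - inner q e *: p | p <- sp, q <- sn].
    by apply/allpairsP; exists (p, q).
  rewrite mem_cat pq_in orbT => /(_ isT).
  move: qn pp; rewrite !mem_filter => /andP[qe _] /andP[pe _].
  rewrite linearBl !linearZl_LR /= subr_le0 => pq.
  rewrite ler_ndivrMr // mulrAC ler_pdivrMr //.
  by rewrite !mulNr lerN2 mulrC [leRHS]mulrC.
exists t => p ps; rewrite linearD linearZ /=.
have [pe|pe|pe] := ltgtP (inner p e) 0.
- have pin : p \in sn by rewrite mem_filter pe.
  have := lt _ (map_f (fun q => - inner q x / inner q e) pin).
  by rewrite ler_ndivrMr // -lerBrDl sub0r.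
- have pin : p \in sp by rewrite mem_filter pe.
  have := ut _ (map_f (fun q => - inner q x / inner q e) pin).
  by rewrite ler_pdivlMr // -lerBrDl sub0r.
- rewrite pe mulr0 addr0; apply: xP.
  by rewrite mem_cat mem_filter pe eqxx ps.
Qed.

(** Elimination is repeated over a basis of [N]; since [N = -N], the result describes the polar cone
    of [s] plus [N]. *)
Lemma polar_seq_add_vspace s (N : {vspace H}) :
  exists s', forall x, polar_seq s' x <-> exists2 n, n \in N & polar_seq s (x + n).
Proof.
rewrite -(span_basis (vbasisP N)); elim: (vbasis N : seq H) => [|e X [s1 s1P]].
  exists s => x; split=> [xs|[n]].
    by exists 0; rewrite ?mem0v ?addr0.
  by rewrite span_nil memv0 => /eqP ->; rewrite addr0.
have [s' s'P] := polar_seq_add_line s1 e.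
exists s' => x; rewrite s'P span_cons; split=> [[t /s1P[n nX xn]]|[n]].
  exists (t *: e + n); last by rewrite addrA.
  by rewrite memv_add // memvZ // memv_line.
move=> /memv_addP[_ /vlineP[t ->] [n' n'X ->]]; rewrite addrA => xn.
by exists t; apply/s1P; exists n'.
Qed.

(** Scaling lets each right-hand side become zero: shrinking a point of [K] shows that it is
    nonnegative, stretching one shows that the inner product is never positive. Nonemptiness rules
    out the empty set, which also satisfies [is_cone]. *)
Lemma polyhedral_cone_polar (K : set H) :
  K !=set0 -> is_cone K -> polyhedral K -> exists s, K = polar_seq s.
Proof.
move=> [k Kk] coneK [s [_ KE]].
have KsP x p : K x -> p \in s -> inner p.1 x <= p.2 by rewrite KE => /[apply].
have s_ge0 p : p \in s -> 0 <= p.2.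
  move=> ps; rewrite leNgt; apply/negP => p2.
  have pk : inner p.1 k < 0 by exact: le_lt_trans (KsP _ _ Kk ps) p2.
  have a0 : 0 < p.2 / 2 / inner p.1 k.
    by rewrite nmulr_lgt0 ?invr_lt0 // pmulr_llt0.
  have := KsP _ _ (coneK _ _ a0 Kk) ps.
  rewrite linearZ /= divfK ?lt_eqF //; lra.
exists (unzip1 s); apply/seteqP; split => x.
  move=> Kx _ /mapP[p ps ->]; rewrite leNgt; apply/negP => px.
  have a0 : 0 < (p.2 + 1) / inner p.1 x.
    by rewrite divr_gt0 // ltr_wpDl ?s_ge0.
  have := KsP _ _ (coneK _ _ a0 Kx) ps.
  by rewrite linearZ /= divfK ?gt_eqF // gerDl leNgt ltr01.
by move=> xs; rewrite KE => p ps; apply: le_trans (s_ge0 _ ps); apply: xs; exact: map_f.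
Qed.

(** The [S]-components of sums tending to [z] have a cluster point [x] in [S]; then [z - x] is a
    limit of elements of [K]. *)
Lemma closed_compact_add (S K : set H) :
  compact S -> closed K -> closed [set x + y | x in S & y in K].
Proof.
move=> cS cK z clz.
pose G := filter_from (nbhs z) (fun U => S `&` [set x | exists2 y, K y & U (x + y)]).
have GF : ProperFilter G.
  apply: filter_from_proper; last first.
    by move=> U /clz[_ [[x Sx [y Ky <-]] Uxy]]; exists x; split => //; exists y.
  apply: filter_from_filter; first by exists setT; exact: filterT.
  move=> U V zU zV; exists (U `&` V); first exact: filterI.
  by move=> x [Sx [y Ky [Ux Vx]]]; split; split => //; exists y.
have [|x [Sx clx]] := cS G GF.
  by exists setT; [exact: filterT|exact: subIsetl].
exists x => //; exists (z - x); last by rewrite addrC subrK.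
apply: cK => V Vzx.
have subc : (fun p : H * H => p.1 - p.2) @ (z, x) --> z - x.
  by apply: cvgB; [exact: cvg_fst|exact: cvg_snd].
have : nbhs (z, x) [set p : H * H | V (p.1 - p.2)] := subc _ Vzx.
move=> [[U1 U2] /= [zU1 xU2] UV].
have [|w [[Sw [y Ky U1wy]] U2w]] := 
    clx (S `&` [set x | exists2 y, K y & U1 (x + y)]) U2 _ xU2; first by exists U1.
exists y; split => //; rewrite (_ : y = (w + y) - w).
  exact: (UV (w + y, w)).
by rewrite addrC addKr.
Qed.

End polyhedral_cones.

(** * The generalized Moreau enhanced cost *)

Lemma sqr_normD (R : realType) (H : hilbertType R) (x y : H) :
  `|x + y| ^+ 2 = `|x| ^+ 2 + 2 * inner x y + `|y| ^+ 2.
Proof.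
rewrite !sqr_normE hnormD expr0 mul1r /=; lra.
Qed.

Lemma linear_lt_quadratic (R : realType) (k p q : R) :
  0 < k -> exists2 t, 1 < t & p * t + q < k * t ^+ 2.
Proof.
(* Then [k * t > |p| + |q| + 1], and [t > 1] lets [|q| * t] dominate [q]. *)
move=> k0; pose t := 1 + (`|p| + `|q| + 1) / k.
have s0 : 0 < (`|p| + `|q| + 1) / k by rewrite divr_gt0 // ltr_wpDl ?addr_ge0.
have t1 : 1 < t by rewrite ltrDl.
exists t => //.
have kt : k * t = k + (`|p| + `|q| + 1) by rewrite mulrDr mulr1 mulrC divfK ?gt_eqF.
rewrite expr2 mulrA kt.
have := ler_norm p; have := ler_norm q; have := normr_ge0 q; nra.
Qed.

Lemma closed_lsc_le (R : realType) (T : topologicalType) (F : T -> \bar R)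
    (g : T -> R) :
  lower_semicontinuous F -> continuous g -> closed [set x | (F x <= (g x)%:E)%E].
Proof.
move=> lscF gc x clx /=; rewrite leNgt; apply/negP => gF.
(* A real [c] strictly between the two values separates them near [x]; [g x + 1] serves when [F x]
   is [+oo]. *)
have [c gc_lt cF] : exists2 c, g x < c & (c%:E < F x)%E.
  case: (F x) gF => [r|_|//]; last by exists (g x + 1); rewrite ?ltrDl ?ltry.
  by rewrite lte_fin => gr; exists ((g x + r) / 2); rewrite ?lte_fin midf_lt.
have [V xV VF] := lscF _ _ cF.
have xU : nbhs x [set y | g y < c] by apply: (gc x [set y | y < c]); exact: lt_nbhsl.
have [y [/= Fy [Vy gy]]] := clx _ (filterI xV xU).
by have := lt_le_trans (VF _ Vy) Fy; rewrite lte_fin ltNge (ltW gy).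
Qed.

Lemma coercive_unbounded_ray (R : realType) (H : hilbertType R) (F : H -> \bar R) (x d : H)
    (M : R) :
  coercive F -> d != 0 -> exists2 t, 0 <= t & (M%:E < F (x + t *: d)%R)%E.
Proof.
move=> /(_ (M + 1))[r rP] d0; have dgt0 : 0 < `|d| by rewrite normr_gt0.
have t0 : 0 <= (`|r| + `|x|) / `|d| by rewrite divr_ge0 ?addr_ge0.
(* Here [|t *: d| - |x| = |r|], hence [|x + t *: d| >= r]. *)
exists ((`|r| + `|x|) / `|d|) => //.
apply: (@lt_le_trans _ _ (M + 1)%:E); first by rewrite lte_fin ltrDl.
apply: rP; rewrite addrC (le_trans _ (lerB_normD _ _)) //.
by rewrite normrZ ger0_norm // divfK ?gt_eqF // addrK ler_norm.
Qed.

Lemma sqr_normB_lfun (R : realType) (Z Zt : hilbertType R) (B : 'Hom(Z, Zt)) (z v : Z) :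
  `|B (z - v)| ^+ 2 = `|B z| ^+ 2 - 2 * inner (B z) (B v) + `|B v| ^+ 2.
Proof. by rewrite linearB sqr_normD normrN linearN mulrN. Qed.

Section gme_cost.
Context {R : realType} {X Y Z Zt : hilbertType R}.
Context (A : 'Hom(X, Y)) (f : Y -> R) (mu : R) (Psi : Z -> \bar R)
  (L : 'Hom(X, Z)) (B : 'Hom(Z, Zt)).
Context (f_cont : continuous f) (mu_gt0 : 0 < mu)
  (Psi_Gamma0 : Gamma0 Psi) (Psi_coercive : coercive Psi)
  (C1 : convex_efun (fun x : X => (f (A x) - mu / 2 * `|B (L x)| ^+ 2)%:E)).

Local Notation cost := (gme_cost A f mu Psi L B).
(** The generalized Moreau envelope of [Psi]. *)
Let env (z : Z) := ereal_inf (range (fun v : Z =>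
  (Psi v + (2^-1 * `|B (z - v)| ^+ 2)%R%:E)%E)).

Let Psi_fin z : (Psi z < +oo)%E -> Psi z = (fine (Psi z))%:E.
Proof.
move: Psi_Gamma0 => [[PsiN _] _ _] Pz.
by rewrite fineK // fin_numE PsiN /= lt_eqF.
Qed.

(** A lower bound of [Psi] bounds it below, and a [v] in [dom Psi] bounds it above; so [gme] never
    meets [+oo - +oo]. *)
Let env_fin z : env z = (fine (env z))%:E.
Proof.
have [m mP] := coercive_Gamma0_has_lbound Psi_Gamma0 Psi_coercive.
move: Psi_Gamma0 => [[PsiN [z0 z0P]] _ _].
rewrite fineK // fin_numE; apply/andP; split.
  have : (m%:E <= env z)%E.
    apply: le_ereal_inf_tmp => _ [v _ <-].
    by rewrite (le_trans (mP v)) // leeDl // lee_fin mulr_ge0 ?sqr_ge0.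
  by case: (env z).
have : (env z <= Psi z0 + (2^-1 * `|B (z - z0)| ^+ 2)%R%:E)%E.
  apply: ge_ereal_inf; exists (Psi z0 + (2^-1 * `|B (z - z0)| ^+ 2)%R%:E)%E => //.
by rewrite (Psi_fin z0P) -EFinD; case: (env z).
Qed.

Lemma gme_cost_lty x : dom Psi (L x) -> (cost x < +oo)%E.
Proof.
move=> /Psi_fin Px; rewrite /gme_cost /gme -/(env (L x)) Px env_fin.
by rewrite -EFinB -EFinM -EFinD ltry.
Qed.

(* The GME cost is the supremum over [v] in [dom Psi] of the functions
   [f (A x) + mu * (Psi (L x) - Psi v - |B (L x - v)|^2 / 2)]. *)
Lemma gme_cost_leP x (M : R) :
  (cost x <= M%:E)%E <-> (forall v, dom Psi v ->
    (Psi (L x) <= (fine (Psi v) + 2^-1 * `|B (L x - v)| ^+ 2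
                   + (M - f (A x)) / mu)%:E)%E).
Proof.
rewrite /gme_cost /gme -/(env (L x)).
(* If [Psi (L x)] is [+oo], both sides fail, the right one at any [v] in [dom Psi]. *)
have [Lx|] := boolP (Psi (L x) < +oo)%E; last first.
  rewrite -leNgt leye_eq => /eqP ->; rewrite env_fin /=.
  rewrite addye // gt0_muley ?lte_fin // addey //.
  move: Psi_Gamma0 => [[PsiN [z0 z0P]] _ _].
  by split=> [//|/(_ _ z0P)].
rewrite (Psi_fin Lx) env_fin -EFinB -EFinM -EFinD lee_fin.
have -> : (f (A x) + mu * (fine (Psi (L x)) - fine (env (L x))) <= M) =
          (fine (Psi (L x)) - (M - f (A x)) / mu <= fine (env (L x))).
  by rewrite addrC -lerBrDr mulrC -ler_pdivlMr // lerBlDr lerBlDr addrC.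
rewrite -lee_fin -env_fin; split => [xM v vP|xM].
  rewrite lee_fin -lerBlDr -lee_fin; apply: le_trans xM _.
  rewrite EFinD -Psi_fin //.
  apply: ge_ereal_inf; exists (Psi v + (2^-1 * `|B (L x - v)| ^+ 2)%R%:E)%E => //.
apply: le_ereal_inf_tmp => _ [v _ <-].
have [vP|] := boolP (Psi v < +oo)%E.
  by rewrite (Psi_fin vP) -EFinD lee_fin lerBlDr -lee_fin; exact: xM.
by rewrite -leNgt leye_eq => /eqP ->; rewrite addye // leey.
Qed.

(** For each [v], a lower semicontinuous function is compared with a continuous one. *)
Lemma closed_gme_cost_sublevel (M : R) : closed [set x | (cost x <= M%:E)%E].
Proof.
rewrite (_ : [set x | _] = \bigcap_(v in dom Psi) [set x | (Psi (L x) <=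
    (fine (Psi v) + 2^-1 * `|B (L x - v)| ^+ 2 + (M - f (A x)) / mu)%:E)%E]); last first.
  by apply/seteqP; split => x /gme_cost_leP.
apply: closed_bigI => v _; apply: closed_lsc_le.
  move=> x a aP; move: Psi_Gamma0 => [_ /(_ _ _ aP)[V xV VP] _].
  exists (L @^-1` V); last by move=> y /VP.
  exact: findim_linear_continuous.
have Lc := @findim_linear_continuous _ X Z L.
have Bc := @findim_linear_continuous _ Z Zt B.
have Ac := @findim_linear_continuous _ X Y A.
move=> x; apply: cvgD.
  apply: cvgD; first exact: cvg_cst.
  apply: cvgM; first exact: cvg_cst.
  under eq_fun do rewrite expr2.
  suff nc : (fun x => `|B (L x - v)|) @ x --> `|B (L x - v)| by apply: cvgM.
  apply: (@cvg_norm _ _ _ _ _ (fun x => B (L x - v))).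
  apply: (cvg_comp (fun x => L x - v) B); last exact: Bc.
  by apply: cvgB; [exact: Lc|exact: cvg_cst].
apply: cvgMr_tmp; apply: cvgB; first exact: cvg_cst.
by apply: (cvg_comp A f); [exact: Ac|exact: f_cont].
Qed.

Let C1_fin (t : R) x y : 0 < t < 1 ->
  f (A (t *: x + (1 - t) *: y)) - mu / 2 * `|B (L (t *: x + (1 - t) *: y))| ^+ 2 <=
  t * (f (A x) - mu / 2 * `|B (L x)| ^+ 2) +
  (1 - t) * (f (A y) - mu / 2 * `|B (L y)| ^+ 2).
Proof. by move=> /(C1 x y); rewrite -!EFinM -EFinD lee_fin. Qed.

(** For fixed [v], expanding the squared norm leaves a cross term linear in [x] and a quadratic term
    that [C1] absorbs together with [f (A x)]. *)
Lemma gme_cost_sublevel_convex (M t : R) x y : 0 <= t <= 1 ->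
  (cost x <= M%:E)%E -> (cost y <= M%:E)%E ->
  (cost ((1 - t) *: x + t *: y)%R <= M%:E)%E.
Proof.
rewrite le_eqVlt => /andP[/predU1P[<- _ xM _|t0]].
  by rewrite subr0 scale1r scale0r addr0.
rewrite le_eqVlt => /predU1P[-> _|t1 xM yM].
  by rewrite subrr scale1r scale0r add0r.
have t01 : 0 < 1 - t < 1 by rewrite subr_gt0 t1 gtrDl oppr_lt0.
apply/gme_cost_leP => v vP.
move/gme_cost_leP/(_ v vP) : xM => xM; move/gme_cost_leP/(_ v vP) : yM => yM.
move: Psi_Gamma0 => [_ _ /(_ (L x) (L y) _ t01)].
rewrite subKr -!linearZ -linearD => PsiC.
have := C1_fin x y t01; rewrite subKr.
have xE := Psi_fin (le_lt_trans xM (ltry _)).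
have yE := Psi_fin (le_lt_trans yM (ltry _)).
rewrite xE lee_fin in xM; rewrite yE lee_fin in yM.
rewrite xE yE -!EFinM -EFinD in PsiC.
move=> gC; apply: le_trans PsiC _; rewrite lee_fin.
have := ler_wpM2l (ltW t0) yM.
have /ler_wpM2l/(_ _ _ xM) : 0 <= 1 - t by rewrite subr_ge0 ltW.
have mu1 : mu^-1 * mu = 1 by rewrite mulVf // gt_eqF.
have muV : 0 < mu^-1 by rewrite invr_gt0.
(* Dividing [C1] by [mu] matches its quadratic term with the half square of the Moreau term. *)
have := ler_wpM2l (ltW muV) gC; rewrite !sqr_normB_lfun.
have -> : inner (B (L ((1 - t) *: x + t *: y))) (B v) =
    (1 - t) * inner (B (L x)) (B v) + t * inner (B (L y)) (B v).
  by rewrite linearD !linearZ linearD !linearZ linearDl !linearZl_LR.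
move: (`|B (L (_ + _))| ^+ 2) (f (A (_ + _))) => bC fC.
move: (`|B (L x)| ^+ 2) (`|B (L y)| ^+ 2) (f (A x)) (f (A y)) => bx by_ fx fy.
have -> : mu^-1 * (fC - mu / 2 * bC) = mu^-1 * fC - bC / 2.
  by rewrite mulrBr !mulrA mu1; ring.
have -> : mu^-1 * ((1 - t) * (fx - mu / 2 * bx) + t * (fy - mu / 2 * by_)) =
    (1 - t) * (mu^-1 * fx - bx / 2) + t * (mu^-1 * fy - by_ / 2).
  have -> : bx / 2 = mu^-1 * mu * bx / 2 by rewrite mu1 mul1r.
  have -> : by_ / 2 = mu^-1 * mu * by_ / 2 by rewrite mu1 mul1r.
  by ring.
lra.
Qed.

(* For [B (L d) != 0], [f \o A - mu / 2 * |B (L _)|^2] would be a convex function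
   bounded above by a concave quadratic along the ray. *)
Lemma gme_cost_ray x d (M : R) : dom Psi (L x) -> has_lbound (range f) ->
  (forall t, 0 <= t -> (cost (x + t *: d)%R <= M%:E)%E) ->
  L d = 0 /\ (coercive (EFin \o f) -> A d = 0).
Proof.
move=> xP [m mP] rayM.
have rayE t v : 0 <= t -> dom Psi v -> (Psi (L x + t *: L d)%R <=
    (fine (Psi v) + 2^-1 * `|B (L (x + t *: d) - v)| ^+ 2
      + (M - f (A (x + t *: d))) / mu)%:E)%E.
  by move=> t0 vP; have /gme_cost_leP/(_ v vP) := rayM t t0; rewrite linearD linearZ.
have ray_dom t : 0 <= t -> dom Psi (L (x + t *: d)).
  by move=> t0; rewrite linearD linearZ; apply: le_lt_trans (rayE _ _ t0 xP) (ltry _).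
(* Taking for [v] the point [L (x + t *: d)] itself makes the Moreau term vanish. *)
have fM t : 0 <= t -> f (A (x + t *: d)) <= M.
  move=> t0; have := rayE _ _ t0 (ray_dom _ t0).
  rewrite subrr linear0 normr0 expr0n mulr0 addr0 -linearZ -linearD.
  rewrite {1}(Psi_fin (ray_dom _ t0)) lee_fin lerDl.
  by rewrite pmulr_lge0 ?invr_gt0 // subr_ge0.
have BLd : B (L d) = 0.
  apply/eqP/negPn/negP => BLd; have bb : 0 < mu / 2 * `|B (L d)| ^+ 2.
    by rewrite mulr_gt0 ?divr_gt0 // exprn_gt0 // normr_gt0.
  pose g y := f (A y) - mu / 2 * `|B (L y)| ^+ 2.
  (* [p] and [q] are the coefficients of the affine upper bound on [mu / 2 * |B (L d)|^2 * t^2] that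
     [C1] and [fM] imply. *)
  pose p := g x - g (x + d) - mu * inner (B (L x)) (B (L d)).
  pose q := M - g x - mu / 2 * `|B (L x)| ^+ 2.
  have [t t1 ] := linear_lt_quadratic p q bb.
  have t0 : 0 < t by exact: lt_trans t1.
  have tV : 0 < t^-1 < 1 by rewrite invr_gt0 t0 invf_lt1.
  have gt := C1_fin (x + t *: d) x tV.
  have {gt} : t * g (x + d) <= g (x + t *: d) + (t - 1) * g x.
    (* [x + d] lies between [x] and [x + t *: d], with weight [t^-1]; hence the choice [t > 1]. *)
    rewrite (_ : x + d = t^-1 *: (x + t *: d) + (1 - t^-1) *: x); last first.
      rewrite scalerDr scalerA mulVf ?gt_eqF // scale1r scalerBl scale1r.
      by rewrite addrAC (addrC (t^-1 *: x)) subrK.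
    rewrite (le_trans (ler_wpM2l (ltW t0) gt)) // -/(g _) -/(g x).
    rewrite le_eqVlt; apply/orP; left; apply/eqP; field; exact: lt0r_neq0.
  have := fM t (ltW t0).
  rewrite ltNge => fMt gt /negP; apply; move: gt; rewrite /p /q.
  rewrite [g (x + t *: d)]/g; move: (g x) (g (x + d)) => gx gxd.
  have -> : B (L (x + t *: d)) = B (L x) + t *: B (L d).
    by rewrite linearD linearZ linearD linearZ.
  have -> : `|B (L x) + t *: B (L d)| ^+ 2 = `|B (L x)| ^+ 2 +
      2 * (t * inner (B (L x)) (B (L d))) + `|t| ^+ 2 * `|B (L d)| ^+ 2.
    by rewrite sqr_normD linearZ normrZ exprMn.
  rewrite real_normK ?num_real //=.
  lra.
have f_lb y : m <= f y by apply: mP; exists y.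
(* With [v = L x] the Moreau term is now zero on the whole ray, so [Psi] stays below a constant
   along it, against coercivity. *)
have Ld : L d = 0.
  apply/eqP/negPn/negP => Ld.
  have [t t0] := coercive_unbounded_ray (L x) (fine (Psi (L x)) + (M - m) / mu) Psi_coercive Ld.
  rewrite ltNge => /negP; apply; apply: le_trans (rayE _ _ t0 xP) _.
  have -> : B (L (x + t *: d) - L x) = 0.
    by rewrite -linearB (addrC x) addrK linearZ linearZ /= BLd scaler0.
  rewrite normr0 expr0n mulr0 addr0.
  by rewrite lee_fin lerD2l ler_pM2r ?invr_gt0 // lerD2l lerN2.
split=> // fco; apply/eqP/negPn/negP => Ad.
have [t t0] := coercive_unbounded_ray (A x) M fco Ad.
by rewrite ltNge lee_fin -linearZ -linearD fM.
Qed.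

(** Common core of cases (i) to (iii): [W] contains no nonzero direction of the kind left by
    [gme_cost_ray], so sublevel sets in [W] are bounded. *)
Lemma gme_cost_attains_min (W : {vspace X}) (D : set X) x :
  has_lbound (range f) -> closed D -> (forall y, D y -> y \in W) ->
  D x -> dom Psi (L x) ->
  (forall d, d \in W -> L d = 0 -> (coercive (EFin \o f) -> A d = 0) -> d = 0) ->
  exists2 p, D p & forall y, D y -> (cost p <= cost y)%E.
Proof.
move=> f_lb clD DW Dx xP WN.
have [a xa] := lty_ex_le_fin (gme_cost_lty xP).
apply: (@attains_min_on _ _ _ _ a); [exact: closed_gme_cost_sublevel|by []| |].
- have [d Wd d0 b|N [Nreal NP]] := bounded_sublevel_of_rays closed_gme_cost_sublevel
    gme_cost_sublevel_convex (DW _ Dx) (gme_cost_lty xP) _ a.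
    apply: contrapT => nt; have [|Ld Ad] := @gme_cost_ray x d b xP f_lb.
      by move=> t t0; rewrite leNgt; apply/negP => bt; apply: nt; exists t.
    by move: d0; rewrite (WN d) ?eqxx.
  exists N; split=> // N' NN' y [Dy ya].
  by apply: NP NN' _ _; split => //; exact: DW.
- by exists x.
Qed.

End gme_cost.

(** * Invariance along the common kernel and existence of minimizers *)

Lemma gme_cost_add_ker (R : realType) (X Y Z Zt : hilbertType R) (A : 'Hom(X, Y))
    (f : Y -> R) (mu : R) (Psi : Z -> \bar R) (L : 'Hom(X, Z)) (B : 'Hom(Z, Zt))
    (x n : X) :
  n \in (lker A :&: lker L)%VS ->
  gme_cost A f mu Psi L B (x + n) = gme_cost A f mu Psi L B x.
Proof.
rewrite memv_cap !memv_ker => /andP[/eqP An /eqP Ln].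
by rewrite /gme_cost !linearD /= An Ln !addr0.
Qed.

Theorem theorem1 (R : realType) (X Y Z Zt Zf : hilbertType R)
    (A : 'Hom(X, Y))
    (f : Y -> R) (gradf : Y -> Y) (beta : R)
    (f_Gamma0 : Gamma0 (EFin \o f))
    (f_grad : forall y : Y, is_gradient f y (gradf y))
    (gradf_lip : beta.-lipschitz gradf)
    (Psi : Z -> \bar R) (Psi_Gamma0 : Gamma0 Psi) (Psi_coercive : coercive Psi)
    (mu : R) (mu_gt0 : 0 < mu)
    (L : 'Hom(X, Z))
    (Delta : set Zf) (Delta_closed : closed Delta)
    (Delta_convex : convex_set Delta)
    (C : 'Hom(X, Zf))
    (B : 'Hom(Z, Zt))
    (feasible : dom (Psi \o L) `&` C @^-1` Delta !=set0)
    (C1 : Gamma0 (fun x : X => (f (A x) - mu / 2 * `|B (L x)| ^+ 2)%:E))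
    (Hcases :
      [\/ coercive (EFin \o f) /\ asymptotically_multipolyhedral (C @^-1` Delta),
          coercive (EFin \o f) /\ (lker A :&: lker L)%VS = 0%VS,
          has_lbound (range f) /\ lker L = 0%VS
        | bounded_set (C @^-1` Delta)]) :
  exists x : X, Delta (C x) /\
    forall y : X, Delta (C y) ->
      (gme_cost A f mu Psi L B x <= gme_cost A f mu Psi L B y)%E.
Proof.
have f_cont : continuous f.
  by move=> y; apply: differentiable_continuous; case: (f_grad y).
move: C1 => [_ _ C1_convex].
have clD : closed (C @^-1` Delta).
  by apply: preimage_closed => // x _; exact: findim_linear_continuous.
move: feasible => [x0 [x0P x0D]].
have f_lb : coercive (EFin \o f) -> has_lbound (range f).
  move=> /(coercive_Gamma0_has_lbound f_Gamma0)[m mP].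
  by exists m => _ [y _ <-]; rewrite -lee_fin; exact: mP.
suff [x xD xmin] : exists2 x, Delta (C x) & forall y, Delta (C y) ->
    (gme_cost A f mu Psi L B x <= gme_cost A f mu Psi L B y)%E by exists x.
have attains := gme_cost_attains_min f_cont mu_gt0 Psi_Gamma0 Psi_coercive C1_convex.
case: Hcases => [[f_co [_ _ [S [K [cS coneK polyK CE]]]]]|[f_co N0]|[flb L0]|bD].
- pose N := (lker A :&: lker L)%VS.
  have [s0 s0S [k0 k0K x0E]] : [set x + y | x in S & y in K] x0 by rewrite -CE.
  have [s KE] := polyhedral_cone_polar (ex_intro _ k0 k0K) coneK polyK.
  have [s' s'P] := polar_seq_add_vspace s N.
  pose T := [set x + y | x in S & y in polar_seq s'].
  (* [T] is [S + K + N]. As the cost is constant along [N], minimizing over the slice of [T] by a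
     complement of [N] suffices. *)
  pose D := T `&` [set x | x \in N^C%VS].
  have splitD y : Delta (C y) -> exists2 w, D w & exists2 n, n \in N & y = w + n.
    move=> yD; have : y \in (N + N^C)%VS by rewrite addv_complf memvf.
    move=> /memv_addP[n nN [w wN yE]]; exists w; last by exists n; rewrite // addrC.
    split => //; have : (C @^-1` Delta) y by [].
    rewrite CE => -[s1 s1S [k1 k1K skE]]; exists s1 => //; exists (k1 - n).
      by apply/s'P; exists n => //; rewrite subrK -KE.
    by rewrite addrA skE yE addrAC subrr add0r.
  have [w0 w0D [n0 n0N x0wE]] := splitD _ x0D.
  have [|||||p [[s1 s1S [k1 /s'P[n nN k1n] p_eq]] _] pmin] :=
      attains N^C%VS D w0 (f_lb f_co).
  + by apply: closedI; [apply: closed_compact_add => //; exact: closed_polar_seq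
                        |exact: closed_vspace].
  + by move=> y [].
  + by [].
  + move: x0P n0N; rewrite /dom /= x0wE memv_cap !memv_ker linearD /=.
    by move=> /[swap] /andP[_ /eqP ->]; rewrite addr0.
  (* Such a [d] lies both in [N] and in its complement. *)
  + move=> d dNC Ld /(_ f_co) Ad; apply/eqP; rewrite -memv0 -(capv_compl N).
    by rewrite memv_cap dNC memv_cap !memv_ker Ad Ld !eqxx.
  (* [p] itself may be infeasible; shifting by [n] brings its cone part back into [K] at the same
     cost. *)
  exists (p + n).
    have : (C @^-1` Delta) (p + n) by rewrite CE KE; exists s1 => //; exists (k1 + n);
      rewrite // addrA p_eq.
    by [].
  move=> y /splitD[w wD [m mN ->]].
  by rewrite !gme_cost_add_ker //; exact: pmin.
- apply: (attains fullv (C @^-1` Delta) x0) => //; [exact: f_lb|by move=> y _; exact: memvf|].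
  move=> d _ Ld /(_ f_co) Ad; apply/eqP.
  by rewrite -memv0 -N0 memv_cap !memv_ker Ad Ld !eqxx.
- apply: (attains fullv (C @^-1` Delta) x0) => //; first by move=> y _; exact: memvf.
  move=> d _ Ld _.
  by apply/eqP; rewrite -memv0 -L0 memv_ker Ld.
(* In case (iv), boundedness of the constraint set replaces the ray argument. *)
- have /lty_ex_le_fin[a x0a] : (gme_cost A f mu Psi L B x0 < +oo)%E.
    exact: gme_cost_lty.
  apply: (@attains_min_on _ _ _ _ a) => //; last by exists x0.
    by move=> b; exact: closed_gme_cost_sublevel.
  have [M [Mreal MP]] := bD; exists M; split => // M' MM' x [xD _].
  exact: MP MM' _ xD.
Qed.
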